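(* Let $G$ be a finite directed multigraph and let $\mathcal D$ be a source-factorizable DAG assignment on $G$, with attaching weight matrix $M$. For any vertex subsets $S,U\subseteq G_V$, $$w(\mathcal D_S(U))=\bigl((I-M)^{-1}\bigr)_{S,U},$$ where $I$ is the identity matrix.
   Context: $G=(G_V,G_E)$ is a finite directed multigraph (loops and parallel edges allowed); each edge $e$ has a source $s(e)$ and a target $t(e)$ in $G_V$. A subgraph $H=(H_V,H_E)$ has $H_V\subseteq G_V$, $H_E\subseteq G_E$, with inherited sources and targets; $H$ is ''on $U$'' if $H_V=U$. For $T\subseteq H_V$, $H|_T$ is the subgraph on $T$ consisting of all edges of $H$ with both source and target in $T$. For subgraphs $H,H'$ with disjoint edge sets, $H'\star H$ is the subgraph with vertex set $H'_V\cup H_V$ and edge set $H'_E\sqcup H_E$. A DAG is a directed graph with no closed walk of length $\ge1$. $\mathsf{Snk}(H)$ is the set of vertices of out-degree $0$ in $H$; $\mathsf{Src}(H)$ is the set of vertices of in-degree $0$; $\mathsf{Nss}(H)=\mathsf{Src}(H)\setminus\mathsf{Snk}(H)$. Weights: $R_{G_E}=\mathbb Z[x_e:e\in G_E]$; $w(H)=\prod_{e\in H_E}x_e$ for a subgraph $H$, and $w(\mathcal S)=\sum_{H\in\mathcal S}w(H)$ for a set $\mathcal S$ of subgraphs. For $U\subseteq G_V$, $\mathsf{DAG}(U)$ is the set of acyclic subgraphs of $G$ on $U$. A DAG assignment $\mathcal D$ on $G$ assigns to each $U\subseteq G_V$ a subset $\mathcal D(U)\subseteq\mathsf{DAG}(U)$.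 For $T\subseteq U\subseteq G_V$ let $\mathcal B(T,U)=\{H\in\mathcal D(U):T\subseteq\mathsf{Nss}(H)\}$. For $H\in\mathcal D(U\setminus T)$, let $\mathcal A_H(T,U)\subseteq\mathsf{DAG}(U)$ be the set of graphs $H'$ on $U$ all of whose edges have source in $T$ and target in $U\setminus T$ and such that $H'\star H\in\mathcal B(T,U)$. $\mathcal D$ is source-factorizable if for all $T\subseteq U\subseteq G_V$: (i) for each $H\in\mathcal B(T,U)$, $H|_{U\setminus T}\in\mathcal D(U\setminus T)$; (ii) all $H\in\mathcal D(U\setminus T)$ induce the same set $\mathcal A_H(T,U)$; (iii) $\mathcal D(U)$ contains the edgeless graph on $U$. In this case $\mathcal A(T,U)$ denotes the common set $\mathcal A_H(T,U)$, and $A(T,U)=w(\mathcal A(T,U))$. The attaching weight matrix $M$ is indexed by the subsets of $G_V$, with entries in $R_{G_E}$: $M_{T,U}=(-1)^{|U\setminus T|-1}A(U\setminus T,U)$ if $T\subsetneq U$, and $M_{T,U}=0$ otherwise. It is strictly upper triangular for inclusion, hence nilpotent. Finally $\mathcal D_S(U)=\{H\in\mathcal D(U):\mathsf{Snk}(H)=S\}$. *)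

(* Defs.v *)
From HB Require Import structures.
From mathcomp Require Import all_boot all_algebra.
From mathcomp Require Import mpoly.

Set Implicit Arguments.
Unset Strict Implicit.
Unset Printing Implicit Defensive.

Import GRing.Theory.
Local Open Scope ring_scope.

Record multigraph := Multigraph {
  vertex : finType;
  edge : finType;
  src : edge -> vertex;
  tgt : edge -> vertex
}.

Section Subgraphs.
Variable G : multigraph.

Definition is_subgraph (p : {set vertex G} * {set edge G}) : bool :=
  [forall e in p.2, (src e \in p.1) && (tgt e \in p.1)].

Record subgraph := Subgraph {
  sgval : {set vertex G} * {set edge G};
  sgvalP : is_subgraph sgval
}.

HB.instance Definition _ := [isSub for sgval].
HB.instance Definition _ := [Finite of subgraph by <:].

Definition verts (H : subgraph) : {set vertex G} := (sgval H).1.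
Definition edges (H : subgraph) : {set edge G} := (sgval H).2.

Definition out_degree (H : subgraph) (v : vertex G) : nat :=
  #|[set e in edges H | src e == v]|.
Definition in_degree (H : subgraph) (v : vertex G) : nat :=
  #|[set e in edges H | tgt e == v]|.

Definition Snk (H : subgraph) : {set vertex G} :=
  [set v in verts H | out_degree H v == 0%N].
Definition Src (H : subgraph) : {set vertex G} :=
  [set v in verts H | in_degree H v == 0%N].
Definition Nss (H : subgraph) : {set vertex G} := Src H :\: Snk H.

Fact edgeless_subproof (U : {set vertex G}) : is_subgraph (U, set0).
Proof. by apply/forall_inP => e; rewrite inE. Qed.
Definition edgeless (U : {set vertex G}) : subgraph :=
  Subgraph (edgeless_subproof U).

Fact restrict_subproof (H : subgraph) (T : {set vertex G}) :
  is_subgraph (T, [set e in edges H | (src e \in T) && (tgt e \in T)]).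
Proof. by apply/forall_inP => e; rewrite inE => /andP[]. Qed.
Definition restrict (H : subgraph) (T : {set vertex G}) : subgraph :=
  Subgraph (restrict_subproof H T).

(* The union of edge sets is a disjoint union wherever [star] is used below:  *)
(* there the edges of H' have their source in T, those of H in U :\: T.       *)
Fact star_subproof (H' H : subgraph) :
  is_subgraph (verts H' :|: verts H, edges H' :|: edges H).
Proof.
apply/forall_inP => e; rewrite !inE => /orP[] eH.
  by have /andP[-> ->] := forall_inP (sgvalP H') e eH.
by have /andP[-> ->] := forall_inP (sgvalP H) e eH; rewrite !orbT.
Qed.
Definition star (H' H : subgraph) : subgraph := Subgraph (star_subproof H' H).

(* A closed walk is a sequence of edges in which the target of each edge is   *)
(* the source of the cyclically next one.                                     *)
Definition closed_walk (H : subgraph) (c : seq (edge G)) : Prop :=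
  {subset c <= edges H} /\ cycle (fun e f : edge G => tgt e == src f) c.

Definition acyclic (H : subgraph) : Prop :=
  forall c : seq (edge G), closed_walk H c -> size c = 0%N.

Definition is_DAG_on (U : {set vertex G}) (H : subgraph) : Prop :=
  verts H = U /\ acyclic H.

(* The ring Z[x_e : e an edge of G]; the variables are numbered by enum_rank. *)
Definition weight_ring := {mpoly int[#|edge G|]}.

Definition weight (H : subgraph) : weight_ring :=
  \prod_(e in edges H) 'X_(enum_rank e).
Definition set_weight (F : {set subgraph}) : weight_ring :=
  \sum_(H in F) weight H.

Record dag_assignment := DagAssignment {
  dag_set :> {set vertex G} -> {set subgraph};
  dag_setP : forall (U : {set vertex G}) (H : subgraph),
    H \in dag_set U -> is_DAG_on U H
}.

Variable D : dag_assignment.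

Definition Bset (T U : {set vertex G}) : {set subgraph} :=
  [set H in D U | T \subset Nss H].

(* Acyclicity of H' is automatic, as its edges all go from T to U :\: T.      *)
Definition Aset_of (H : subgraph) (T U : {set vertex G}) : {set subgraph} :=
  [set H' : subgraph |
    [&& verts H' == U,
        [forall e in edges H', (src e \in T) && (tgt e \in U :\: T)]
      & star H' H \in Bset T U]].

Definition source_factorizable : Prop :=
  forall T U : {set vertex G}, T \subset U ->
    [/\ forall H, H \in Bset T U -> restrict H (U :\: T) \in D (U :\: T),
        forall H1 H2, H1 \in D (U :\: T) -> H2 \in D (U :\: T) ->
          Aset_of H1 T U = Aset_of H2 T U
      & edgeless U \in D U].

(* The common value of the sets Aset_of H T U, read off at the edgeless graph *)
(* on U :\: T; see Aset_ofE.                                                  *)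
Definition Aset (T U : {set vertex G}) : {set subgraph} :=
  Aset_of (edgeless (U :\: T)) T U.

Lemma Aset_ofE (T U : {set vertex G}) (H : subgraph) :
  source_factorizable -> T \subset U -> H \in D (U :\: T) ->
  Aset_of H T U = Aset T U.
Proof.
move=> sfD sTU DH; have [_ eqA _] := sfD T U sTU; apply: eqA => //.
by have [] := sfD set0 (U :\: T) (sub0set _).
Qed.

Definition attaching_weight (T U : {set vertex G}) : weight_ring :=
  set_weight (Aset T U).

(* Rows and columns are indexed by vertex subsets through enum_rank/enum_val. *)
Definition attaching_matrix : 'M[weight_ring]_#|{set vertex G}| :=
  \matrix_(i, j)
    let T : {set vertex G} := enum_val i in
    let U : {set vertex G} := enum_val j in
    if T \proper U then
      (-1) ^+ (#|U :\: T| - 1)%N * attaching_weight (U :\: T) U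
    else 0.

Definition dag_with_sinks (S U : {set vertex G}) : {set subgraph} :=
  [set H in D U | Snk H == S].

End Subgraphs.

(* Main.v *)
Require Import Defs.
From mathcomp Require Import all_boot all_algebra.
From mathcomp Require Import mpoly.

Import GRing.Theory.
Local Open Scope ring_scope.

(** Let [W] be the matrix with entries [w(D_S(U))].  It suffices to show
    [W (I - M) = I], since a one-sided inverse of a square matrix over a
    commutative ring is two-sided.

    A member [K] of [B(X,U)] is the same thing as a pair consisting of a member
    [H] of [D(U \ X)] and a member [H'] of [A(X,U)]: take [H] to be the
    restriction of [K] to [U \ X] and [H'] to consist of the edges of [K] that
    leave [X].  No edge of [K] enters [X], so nothing is lost, and source
    factorizability says exactly that [H] and [H'] may be chosen independently.
    The vertices of [X] are not sinks of [K], and the vertices of [U \ X] have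
    the same out-edges in [K] and in [H], so [K] and [H] have the same sinks.
    Hence ([sinks_mul_attaching])
      [w(D_S(U \ X)) A(X,U)] is the sum of [w(K)] over the [K] in [D_S(U)]
      with [X] contained in [Nss(K)].

    Entry [(S,U)] of [W (I - M)] is thus the sum over [X] contained in [U] of
    [(-1)^|X|] times this quantity, the term of the empty [X] coming from [I].
    Exchanging the sums, each [K] in [D_S(U)] is weighted by the alternating sum over the
    subsets of [Nss(K)], which vanishes unless [Nss(K)] is empty
    ([sum_sign_subset]).  In a DAG, going backwards from any edge one reaches a
    source that is not a sink ([acyclic_Nss0]); so the only surviving [K] is the
    edgeless graph on [U], which has weight [1] and sink set [U]. *)

Section SourceFactorization.

Set Implicit Arguments.
Unset Strict Implicit.
Unset Printing Implicit Defensive.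

(** * Alternating sums *)

(** The expansion of the product of [-1 + 1] over [N]. *)
Lemma sum_sign_subset (R : comNzRingType) (T : finType) (N : {set T}) :
  \sum_(X : {set T} | X \subset N) (-1) ^+ #|X| = (N == set0)%:R :> R.
Proof.
transitivity (\prod_(v : T) ((if v \in N then -1 else 0) + 1) : R).
  rewrite bigA_distr.
  rewrite [RHS](bigID (fun X : {set T} => X \subset N)) /= [X in _ + X]big1 ?addr0.
    apply: eq_bigr => X sXN; rewrite -prodr_const big_mkcond /=.
    by apply: eq_bigr => v _; case: ifP => // vX; rewrite (subsetP sXN).
  move=> X /subsetPn[v vX vN].
  by rewrite (bigD1 v) //= vX (negbTE vN) mul0r.
have [-> | [v vN]] := set_0Vmem N.
  by rewrite eqxx big1 // => v _; rewrite inE add0r.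
rewrite (bigD1 v) //= vN addNr mul0r.
by case: eqP vN => // ->; rewrite inE.
Qed.

(** * Acyclic graphs *)

Lemma exists_fcycle (T : finType) (f : T -> T) (x : T) :
  exists n i, fcycle f (traject f (iter i f x) n.+1).
Proof.
have /trajectP[i lt_i eq_i] := looping_order f x.
exists (order f x - i).-1, i.
set y := iter i f x; rewrite prednK ?subn_gt0 //.
have fix_y : iter (order f x - i) f y = y.
  by rewrite /y -iterD subnK ?(ltnW lt_i).
case: (order f x - i)%N fix_y => // m fix_y.
rewrite /= -[X in rcons _ X]fix_y iterSr -trajectSr.
exact: fpath_traject.
Qed.

Section Graph.
Variable G : multigraph.
Implicit Types (H K : subgraph G) (S T U X : {set vertex G}).

Lemma subgraph_eq H K : verts H = verts K -> edges H = edges K -> H = K.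
Proof.
move=> eqV eqE; apply: val_inj; rewrite /= (surjective_pairing (sgval H)).
by rewrite (surjective_pairing (sgval K)); congr pair.
Qed.

Lemma src_verts H e : e \in edges H -> src e \in verts H.
Proof. by move=> eH; have /andP[] := forall_inP (sgvalP H) e eH. Qed.

Lemma tgt_verts H e : e \in edges H -> tgt e \in verts H.
Proof. by move=> eH; have /andP[] := forall_inP (sgvalP H) e eH. Qed.

Lemma src_notin_Snk H e : e \in edges H -> src e \notin Snk H.
Proof.
move=> eH; rewrite inE negb_and orbC -lt0n.
by apply/orP; left; apply/card_gt0P; exists e; rewrite !inE eH /=.
Qed.

Lemma tgt_notin_Src H e : e \in edges H -> tgt e \notin Src H.
Proof.
move=> eH; rewrite inE negb_and orbC -lt0n.
by apply/orP; left; apply/card_gt0P; exists e; rewrite !inE eH /=.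
Qed.

(** If every source is a sink then the source of each edge has an in-edge, so
    one can go backwards from edge to edge forever, and hence around a cycle. *)
Lemma acyclic_Nss0 H : acyclic H -> Nss H = set0 -> edges H = set0.
Proof.
move=> acH Nss0; apply/eqP; apply: contraT => /set0Pn[e0 e0H].
pose prev e := odflt e [pick f in edges H | tgt f == src e].
have prevE e : e \in edges H -> (prev e \in edges H) && (tgt (prev e) == src e).
  move=> eH; rewrite /prev; case: pickP => //= none.
  have : src e \notin Nss H by rewrite Nss0 inE.
  rewrite inE src_notin_Snk //= inE src_verts //= -lt0n.
  by case/card_gt0P=> f; rewrite !inE none.
have iterH i e : e \in edges H -> iter i prev e \in edges H.
  by elim: i => //= i IHi eH; case/andP: (prevE _ (IHi eH)).
have [n [i]] := exists_fcycle prev e0.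
set c := traject _ _ _ => cyc.
have cH : {subset c <= edges H}.
  by move=> _ /trajectP[j _ ->]; rewrite !iterH.
(* Walking backwards lists the edges of the closed walk in reverse order. *)
have : size (rev c) = 0%N.
  apply: acH; split; first by move=> e; rewrite mem_rev; apply: cH.
  rewrite rev_cycle; apply: (@sub_in_cycle _ (mem (edges H)) (frel prev)) cyc.
    by move=> e f eH _ /= /eqP <-; case/andP: (prevE e eH).
  by apply/allP.
by rewrite size_rev size_traject.
Qed.

Lemma weight_edgeless U : weight (edgeless U) = 1.
Proof. by rewrite /weight big_set0. Qed.

Lemma Snk_edgeless U : Snk (edgeless U) = U.
Proof.
apply/setP=> v; rewrite inE /= /verts /=.
case: (v \in U) => //=; apply/eqP/eqP; rewrite cards_eq0; apply/eqP/setP=> e.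
by rewrite !inE.
Qed.

Lemma Nss_edgeless U : Nss (edgeless U) = set0.
Proof.
apply/eqP; rewrite setD_eq0 Snk_edgeless.
by apply/subsetP=> v; rewrite inE => /andP[].
Qed.

(** * Splitting off a set of sources *)

Fact out_part_subproof X K :
  is_subgraph (verts K, [set e in edges K | src e \in X]).
Proof.
by apply/forall_inP=> e; rewrite inE => /andP[eK _]; rewrite src_verts ?tgt_verts.
Qed.

Definition out_part X K : subgraph G := Subgraph (out_part_subproof X K).

Lemma Nss_verts K : Nss K \subset verts K.
Proof. by apply/subsetP=> v; rewrite !inE => /andP[_ /andP[]]. Qed.

Lemma tgt_notin_Nss X K e :
  X \subset Nss K -> e \in edges K -> tgt e \notin X.
Proof.
move=> /subsetP sXN eK; apply: contra (tgt_notin_Src eK) => /sXN.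
by rewrite inE => /andP[].
Qed.

(** No edge is lost: an edge that does not leave [X] stays in the complement,
    because [X] consists of sources. *)
Lemma star_out_part X K :
  X \subset Nss K -> star (out_part X K) (restrict K (verts K :\: X)) = K.
Proof.
move=> sXN; apply: subgraph_eq; first by apply/setUidPl/subsetDl.
apply/setP=> e; rewrite !inE.
case eK: (e \in edges K) => //=.
rewrite src_verts ?tgt_verts // (tgt_notin_Nss sXN eK) !andbT.
exact: orbN.
Qed.

(** The restriction deletes only edges leaving [X], and no vertex of [X] is a
    sink. *)
Lemma Snk_restrict X K :
  X \subset Nss K -> Snk (restrict K (verts K :\: X)) = Snk K.
Proof.
move=> sXN; apply/setP=> v; rewrite !inE.
case vX: (v \in X) => /=.
  by have := subsetP sXN v vX; rewrite !inE => /andP[/negbTE ->].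
congr (_ && (_ == _)); apply: eq_card => e; rewrite !inE.
case eK: (e \in edges K) => //=; case: eqP => [Ev|]; last by rewrite !andbF.
by rewrite src_verts ?tgt_verts // (tgt_notin_Nss sXN eK) Ev vX.
Qed.

Variable D : dag_assignment G.

Lemma dag_verts U H : H \in D U -> verts H = U.
Proof. by case/(dag_setP (d := D)). Qed.

Section Attach.
Variables (X U : {set vertex G}) (H H' : subgraph G).
Hypotheses (DH : H \in D (U :\: X)) (AH' : H' \in Aset_of D H X U).

Let edgesH e : e \in edges H -> (src e \notin X) && (tgt e \notin X).
Proof.
move=> eH; have := src_verts eH; have := tgt_verts eH.
by rewrite (dag_verts DH) !inE => /andP[-> _] /andP[-> _].
Qed.

Let edgesH' e : e \in edges H' -> (src e \in X) && (tgt e \in U :\: X).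
Proof. by move: AH'; rewrite inE => /and3P[_ /forall_inP] => /(_ e). Qed.

Lemma out_part_star : out_part X (star H' H) = H'.
Proof.
apply: subgraph_eq.
  move: AH'; rewrite inE => /and3P[/eqP vH' _ _].
  by apply/setUidPl; rewrite vH' (dag_verts DH) subsetDl.
apply/setP=> e; rewrite !inE.
case eH': (e \in edges H') => /=; first by case/andP: (edgesH' eH').
by case eH: (e \in edges H) => //=; case/andP: (edgesH eH) => /negbTE.
Qed.

Lemma restrict_star : restrict (star H' H) (U :\: X) = H.
Proof.
apply: subgraph_eq; first by rewrite (dag_verts DH).
apply/setP=> e; rewrite inE -(dag_verts DH) inE /=.
case eH: (e \in edges H); first by rewrite orbT src_verts ?tgt_verts.
rewrite orbF; case eH': (e \in edges H') => //=.
by rewrite (dag_verts DH) inE; case/andP: (edgesH' eH') => ->.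
Qed.

Lemma weight_star : weight (star H' H) = weight H * weight H'.
Proof.
rewrite mulrC /weight -bigU /=; first by apply: eq_bigl => e; rewrite !inE.
rewrite disjoint_subset; apply/subsetP=> e /edgesH'/andP[sX _].
by rewrite inE; apply/negP=> /edgesH; rewrite sX.
Qed.

End Attach.

Lemma out_part_Aset X U K :
  K \in Bset D X U -> out_part X K \in Aset_of D (restrict K (U :\: X)) X U.
Proof.
move=> BK; have := BK; rewrite inE => /andP[/dag_verts vK sXN].
subst U; rewrite inE star_out_part // BK andbT eqxx /=.
apply/forall_inP=> e; rewrite !inE => /andP[eK ->] /=.
by rewrite (tgt_notin_Nss sXN eK) tgt_verts.
Qed.

Hypothesis sfD : source_factorizable D.

(** The product on the left expands over pairs [(H, H')], and [star H' H] runs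
    once through the graphs [K] on the right; the inverse map sends [K] to its
    restriction and its [out_part].  Independence of the choice of [H'] from that
    of [H] is [Aset_ofE]. *)
Lemma sinks_mul_attaching S X U : X \subset U ->
  set_weight (dag_with_sinks D S (U :\: X)) * attaching_weight D X U =
  \sum_(K in dag_with_sinks D S U | X \subset Nss K) weight K.
Proof.
move=> sXU; have [resD _ _] := sfD sXU.
have BP K : (K \in dag_with_sinks D S U) && (X \subset Nss K) =
            (K \in Bset D X U) && (Snk K == S).
  by rewrite !inE andbAC.
rewrite (eq_bigl _ _ BP).
have SnkB K : K \in Bset D X U -> Snk (restrict K (U :\: X)) = Snk K.
  by rewrite inE => /andP[/dag_verts <-]; apply: Snk_restrict.
rewrite (partition_big (fun K => restrict K (U :\: X))
           (mem (dag_with_sinks D S (U :\: X)))) /=; last first.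
  by move=> K /andP[BK SK]; rewrite inE resD // SnkB.
rewrite /set_weight mulr_suml; apply: eq_bigr => H.
rewrite inE => /andP[DH /eqP SH].
rewrite /attaching_weight -(Aset_ofE sfD sXU DH) /set_weight mulr_sumr.
rewrite [RHS](reindex_onto (fun H' => star H' H) (out_part X)) /=; last first.
  move=> K /andP[/andP[BK _] /eqP <-].
  by move: BK; rewrite inE => /andP[/dag_verts <-]; apply: star_out_part.
have starP H' : (H' \in Aset_of D H X U) =
    (star H' H \in Bset D X U) && (Snk (star H' H) == S)
    && (restrict (star H' H) (U :\: X) == H) && (out_part X (star H' H) == H').
  apply/idP/andP=> [AH' | [/andP[/andP[BK _] /eqP resH] /eqP <-]].
    have BK : star H' H \in Bset D X U by move: AH'; rewrite inE => /and3P[].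
    by rewrite BK -SnkB // (restrict_star DH) // (out_part_star DH) // SH !eqxx.
  by rewrite -[X in Aset_of _ X]resH out_part_Aset.
under [RHS]eq_bigl => H' do rewrite -starP.
by apply: eq_bigr => H' AH'; rewrite (weight_star DH AH').
Qed.

(** * Inverting the attaching matrix *)

Lemma edgeless_dag U : edgeless U \in D U.
Proof. by have [] := sfD (sub0set U). Qed.

(** Only the edgeless graph on [U] can contribute. *)
Lemma sum_no_Nss S U :
  \sum_(K in dag_with_sinks D S U | Nss K == set0) weight K = (S == U)%:R.
Proof.
have uniqK K : K \in D U -> Nss K = set0 -> K = edgeless U.
  move=> DK Nss0; have [vK acK] := dag_setP DK.
  by apply: subgraph_eq; rewrite ?vK ?(acyclic_Nss0 acK Nss0).
have [->|neSU] := eqVneq S U.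
  rewrite (bigD1 (edgeless U)) /=; last first.
    by rewrite inE edgeless_dag Snk_edgeless Nss_edgeless !eqxx.
  rewrite weight_edgeless big1 ?addr0 // => K /andP[/andP[]].
  by rewrite inE => /andP[DK _] /eqP/(uniqK K DK) ->; rewrite eqxx.
rewrite big1 // => K /andP[]; rewrite inE => /andP[DK /eqP SK].
move=> /eqP/(uniqK K DK) EK; case/eqP: neSU.
by rewrite -SK EK Snk_edgeless.
Qed.

Definition sink_matrix : 'M[weight_ring G]_#|{set vertex G}| :=
  \matrix_(i, j) set_weight (dag_with_sinks D (enum_val i) (enum_val j)).

(** Summing over the complement [X] of [T] in [U] absorbs the shift in the
    exponent of [M]: the product [W M] supplies the terms with nonempty [X] of an
    alternating sum whose term at the empty set is [W] itself. *)
Lemma sink_attaching_entry S U :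
  \sum_(T : {set vertex G}) set_weight (dag_with_sinks D S T) *
    (if T \proper U then (-1) ^+ (#|U :\: T| - 1)%N * attaching_weight D (U :\: T) U
     else 0) =
  - \sum_(X : {set vertex G} | (X \subset U) && (X != set0))
      (-1) ^+ #|X| * \sum_(K in dag_with_sinks D S U | X \subset Nss K) weight K.
Proof.
rewrite (bigID (fun T => T \proper U)) /= addrC big1 ?add0r; last first.
  by move=> T /negbTE ->; rewrite mulr0.
rewrite (reindex_onto (fun X => U :\: X) (fun T => U :\: T)) /=; last first.
  by move=> T /proper_sub sTU; rewrite setDDr setDv set0U (setIidPr sTU).
rewrite -sumrN; apply: eq_big => [X | X /andP[prUX /eqP XE]].
  rewrite setDDr setDv set0U properE subsetDl /= subsetD subxx /=.
  have [sXU | nsXU] := boolP (X \subset U); last first.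
    by apply/negbTE; rewrite negb_and orbC; apply/orP; left;
       apply: contra nsXU => /eqP <-; apply: subsetIl.
  by rewrite (setIidPr sXU) eqxx andbT -setI_eq0 (setIidPr sXU).
rewrite prUX XE -sinks_mul_attaching; last by rewrite -XE subsetDl.
have X_gt0 : (0 < #|X|)%N.
  rewrite card_gt0; apply: contraTneq prUX => ->.
  by rewrite setD0 properxx.
rewrite -{2}(subnK X_gt0) addn1 exprS mulN1r mulNr opprK.
by rewrite mulrCA.
Qed.

Lemma sink_matrix_inverse : sink_matrix *m (1%:M - attaching_matrix D) = 1%:M.
Proof.
apply/matrixP=> i j; rewrite mulmxBr mulmx1 !mxE.
set S := enum_val i; set U := enum_val j.
under eq_bigr => k do rewrite !mxE /=.
rewrite -(big_enum_val (A := {set vertex G}) (fun T =>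
  set_weight (dag_with_sinks D S T) *
    if T \proper U then
      (-1) ^+ (#|U :\: T| - 1)%N * attaching_weight D (U :\: T) U
    else 0)) /= sink_attaching_entry opprK.
set P := fun X => \sum_(K in dag_with_sinks D S U | X \subset Nss K) weight K.
(* The entry of [W] is the missing term of the alternating sum. *)
have -> : set_weight (dag_with_sinks D S U) = (-1) ^+ #|@set0 (vertex G)| * P set0.
  by rewrite cards0 mul1r /P; apply: eq_bigl => K; rewrite sub0set andbT.
rewrite -(bigD1 (P := fun X : {set vertex G} => X \subset U) set0) ?sub0set //=.
under eq_bigr => X _ do rewrite /P mulr_sumr.
rewrite (exchange_big_dep (mem (dag_with_sinks D S U))) /=; last first.
  by move=> X K _ /andP[].
rewrite (eq_bigr (fun K => if Nss K == set0 then weight K else 0)).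
  by rewrite -big_mkcondr sum_no_Nss (inj_eq enum_val_inj).
move=> K DK; rewrite -mulr_suml (eq_bigl (fun X => X \subset Nss K)).
  by rewrite sum_sign_subset; case: eqP; rewrite ?mul1r ?mul0r.
move=> X; rewrite DK /=; apply: andb_idl => /subset_trans; apply.
by move: DK; rewrite inE => /andP[/dag_verts <- _]; apply: Nss_verts.
Qed.

End Graph.
End SourceFactorization.

(* invmx A is A itself when A is not invertible, so that invertibility has to *)
(* be asserted for invmx to denote the inverse matrix.                        *)
Theorem theorem3p2 (G : multigraph) (D : dag_assignment G)
    (sfD : source_factorizable D) :
  (1%:M - attaching_matrix D) \in unitmx /\
  forall S U : {set vertex G},
    set_weight (dag_with_sinks D S U) =
    invmx (1%:M - attaching_matrix D) (enum_rank S) (enum_rank U).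
Proof.
have WM1 := sink_matrix_inverse sfD; have [_ unitM] := mulmx1_unit WM1.
split=> // S U; have := mulmxK unitM (sink_matrix D).
by rewrite WM1 mul1mx => ->; rewrite mxE !enum_rankK.
Qed.
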